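(* Let $p,q$ be real numbers with $p>1$, $q>1$ and $p+q>3$. Then \[ \sum_{n=1}^\infty\left(\zeta(p)-\sum_{j=1}^n\frac1{j^p}\right) \left(\zeta(q)-\sum_{k=1}^n\frac1{k^q}\right)= \zeta(p,q-1)+\zeta(q,p-1)+\zeta(p+q-1)-\zeta(p)\zeta(q). \]
   Context: $\zeta$ denotes the Riemann zeta function. For real numbers $a,b$ the double zeta value is $\zeta(a,b)=\sum_{n_1>n_2\ge 1} n_1^{-a}n_2^{-b}$ (convergent when $a>1$ and $a+b>2$). *)

(* Defs.v *)
From mathcomp Require Import all_boot all_order all_algebra.
From mathcomp Require Import all_classical all_reals all_analysis.

Set Implicit Arguments.
Unset Strict Implicit.
Unset Printing Implicit Defensive.

Import Order.TTheory GRing.Theory Num.Theory.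
Import numFieldNormedType.Exports.

Local Open Scope classical_set_scope.
Local Open Scope ring_scope.

(* The Riemann zeta function at a real argument s > 1, where it is given by
   its Dirichlet series; [riemannR s n] is 1 / (n + 1)^s. *)
Definition zeta {R : realType} (s : R) : R := limn (series (riemannR s)).

(* The terms are positive, so the double series is an unordered sum in the
   extended reals; [fine] is meaningful when the sum is finite, in particular
   for a > 1 and a + b > 2. *)
Definition zeta2 {R : realType} (a b : R) : R :=
  fine (\esum_(n in [set n : nat * nat | (1 <= n.2 < n.1)%N])
          (n.1%:R `^ (- a) * n.2%:R `^ (- b))%:E).

(* Main.v *)
Require Import Defs.
From mathcomp Require Import all_boot all_order all_algebra.
From mathcomp Require Import all_classical all_reals all_analysis.
From mathcomp Require Import lra zify.
Import Order.TTheory GRing.Theory Num.Theory.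
Import numFieldNormedType.Exports.

Local Open Scope classical_set_scope.
Local Open Scope ring_scope.

(* Expand the product of the two tails as a sum of 1 / (j^p k^q) over j, k > n.
   The terms being nonnegative, the sum over n >= 0 can be exchanged with the
   one over (j, k), in which each pair is then counted min (j, k) times.  The
   pairs with j > k, j < k and j = k contribute zeta(p, q - 1), zeta(q, p - 1)
   and zeta(p + q - 1), and the term n = 0 to be removed is zeta(p) zeta(q).
   Since [riemannR s n] is 1 / (n + 1)^s, all indices below are shifted by 1,
   and the multiplicity reads [(minn j k).+1]. *)

(** * Terms and convergence of the zeta series *)

Lemma riemannR_ge0 (R : realType) (s : R) n : 0 <= riemannR s n.
Proof. by rewrite /riemannR invr_ge0 powR_ge0. Qed.

Lemma riemannRD (R : realType) (s t : R) n :
  riemannR (s + t) n = riemannR s n * riemannR t n.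
Proof. by rewrite /riemannR powRD ?pnatr_eq0 ?implybT// invfM. Qed.

Lemma riemannR1 (R : realType) n : riemannR (1 : R) n = n.+1%:R^-1.
Proof. by rewrite /riemannR powRr1. Qed.

(** Later turns the multiplicity of a pair into the exponents q - 1, p - 1 and p + q - 1. *)
Lemma riemannRB1 (R : realType) (s : R) n :
  riemannR (s - 1) n = n.+1%:R * riemannR s n.
Proof.
rewrite -{2}(subrK 1 s) (riemannRD _ (s - 1) 1) riemannR1 mulrCA.
by rewrite divff ?mulr1// pnatr_eq0.
Qed.

Lemma ler_riemannR (R : realType) (s : R) m n : 0 <= s -> (m <= n)%N ->
  riemannR s n <= riemannR s m.
Proof.
move=> s0 mn; rewrite /riemannR lef_pV2 ?posrE ?powR_gt0//.
by apply: ge0_ler_powR => //; rewrite ?nnegrE ?ler_nat.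
Qed.

(** Discrete integral test: summed over n, the right-hand side telescopes and bounds the series of
    exponent 1 + t. *)
Lemma riemannR_telescope (R : realType) (t : R) n : 0 <= t ->
  t * riemannR (1 + t) n.+1 <= riemannR t n - riemannR t n.+1.
Proof.
move=> t0; rewrite lerBrDr riemannRD riemannR1 /riemannR.
have n2 : 0 < n.+2%:R :> R by [].
have n2V : n.+2%:R^-1 < 1 :> R by rewrite invf_lt1// ltr1n.
have ratioE : n.+1%:R / n.+2%:R = 1 + - n.+2%:R^-1 :> R.
  by rewrite -(natr1 n.+1) -[X in X / _](addrK 1) mulrBl divff ?mul1r// natr1.
(* With x = (n + 1) / (n + 2):
   x ^ (- t) = exp (- t * ln x) >= 1 - t * ln x >= 1 + t * (1 - x). *)
have le_ratio : 1 + t / n.+2%:R <= (n.+1%:R / n.+2%:R) `^ (- t) :> R.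
  rewrite /powR gt_eqF ?divr_gt0//; apply: le_trans (expR_ge1Dx _).
  by rewrite lerD2l mulNr -mulrN ler_wpM2l// lerNr ratioE le_ln1Dx// ltrN2.
rewrite mulrA -[X in _ + X]mul1r -mulrDl addrC.
apply: le_trans (ler_wpM2r _ le_ratio) _; first by rewrite invr_ge0 powR_ge0.
rewrite powRN powRM// ?invr_ge0// invfM -mulrA -invfM -powRM ?invr_ge0//.
by rewrite mulVf ?gt_eqF// powR1 invr1 mulr1.
Qed.

Lemma is_cvg_riemannR (R : realType) (s : R) : 1 < s ->
  cvgn (series (riemannR s)).
Proof.
move=> s1; apply: nondecreasing_is_cvgn.
  apply: nondecreasing_series => n _ _; exact: riemannR_ge0.
have t0 : 0 < s - 1 by rewrite subr_gt0.
exists (1 + (s - 1)^-1) => _ [n _ <-].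
apply: (@le_trans _ _ (series (riemannR s) n.+1)).
  by rewrite seriesSr lerDl riemannR_ge0.
(* This sharper bound, which keeps the last telescoping term, is the one that passes through the
   induction. *)
apply: (@le_trans _ _ (1 + (1 - riemannR (s - 1) n) / (s - 1))); last first.
  by rewrite lerD2l ler_pdivrMr// mulVf ?gt_eqF// gerBl riemannR_ge0.
elim: n => [|n IH].
  rewrite seriesSr /series/= big_nil add0r /riemannR !powR1 invr1.
  by rewrite subrr mul0r addr0.
rewrite seriesSr (le_trans (lerD IH (lexx _)))// -addrA lerD2l.
rewrite -lerBrDl -mulrBl ler_pdivlMr// mulrC.
have := riemannR_telescope _ _ n (ltW t0); rewrite (addrC 1) subrK; lra.
Qed.

(** * Zeta tails and products as unordered sums *)

Local Open Scope ereal_scope.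

(** The subtracted terms are [riemannR s i] for i < n, so the tail starts at index n. *)
Lemma zeta_tail (R : realType) (s : R) n : (1 < s)%R ->
  (zeta s - \sum_(1 <= j < n.+1) (j%:R `^ s)^-1)%:E =
  \esum_(j in [set j | (n <= j)%N]) (riemannR s j)%:E.
Proof.
move=> s1.
have r0 k : 0 <= (riemannR s k)%:E by rewrite lee_fin riemannR_ge0.
rewrite -(@nneseries_esum _ _ (leq n))//.
rewrite -[RHS](@eseries_cond _ _ xpredT n).
rewrite EFinB /zeta -EFin_lim; last exact: is_cvg_riemannR.
have -> : EFin \o series (riemannR s) =
    (fun k => \sum_(0 <= i < k) (riemannR s i)%:E).
  by apply/funext => k; rewrite /= sumEFin.
rewrite (@nneseries_split _ _ 0 n)// add0n big_add1 -sumEFin addeC addeA.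
by rewrite [X in X + _]addeC subee ?add0e// sumEFin.
Qed.

Lemma zeta_esum (R : realType) (s : R) : (1 < s)%R ->
  (zeta s)%:E = \esum_(j in [set: nat]) (riemannR s j)%:E.
Proof.
move=> s1; have := zeta_tail _ _ 0 s1; rewrite big_geq// subr0 => ->.
by congr (esum _ _); apply/seteqP; split.
Qed.

(** Tonelli: both sides are sums over a product set, matched by swapping the coordinates. *)
Lemma exchange_esum (R : realType) (S T : choiceType) (A : set S) (B : set T)
    (a : S -> T -> \bar R) : (forall i j, 0 <= a i j) ->
  \esum_(i in A) \esum_(j in B) a i j = \esum_(j in B) \esum_(i in A) a i j.
Proof.
move=> a0; rewrite !esum_esum//.
rewrite (reindex_esum (B `*` A) _ (fun x => (x.2, x.1)))//; split=> //=.
- by move=> [i j] [].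
- by move=> [i1 i2] [j1 j2] /= _ _ [-> ->].
- by move=> [i1 i2] [Pi1 Qi2] /=; exists (i2, i1).
Qed.

Lemma esumZl (R : realType) (A : set nat) (c : R) (a : nat -> \bar R) :
  (0 <= c)%R -> (forall i, 0 <= a i) ->
  \esum_(i in A) (c%:E * a i) = c%:E * \esum_(i in A) a i.
Proof.
move=> c0 a0.
(* [nneseries_esum] expects a set given by a boolean predicate. *)
have AE : A = [set i | i \in A].
  by apply/seteqP; split=> i /=; rewrite inE.
rewrite AE -!nneseries_esum ?nneseriesZl// => i _.
by rewrite mule_ge0// lee_fin.
Qed.

Lemma esumM (R : realType) (A B : set nat) (a b : nat -> R) (x y : R) :
  (forall i, (0 <= a i)%R) -> (forall i, (0 <= b i)%R) ->
  x%:E = \esum_(i in A) (a i)%:E -> y%:E = \esum_(j in B) (b j)%:E ->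
  (x * y)%:E = \esum_(z in A `*` B) (a z.1 * b z.2)%:E.
Proof.
move=> a0 b0 xE yE.
have y0 : (0 <= y)%R.
  by rewrite -lee_fin yE esum_ge0// => i _; rewrite lee_fin.
transitivity (\esum_(i in A) \esum_(j in B) (a i * b j)%:E); last first.
  rewrite esum_esum => [|i j _ _]; last by rewrite lee_fin mulr_ge0.
  by congr (esum _ _); apply/seteqP; split.
rewrite (eq_esum (b := fun i => y%:E * (a i)%:E)); last first.
  by move=> i _; rewrite muleC yE -esumZl// => k; rewrite lee_fin.
by rewrite esumZl// -xE mulrC.
Qed.

(** Used with m = [(minn j k).+1] to count the n whose two tails both contain the pair (j, k). *)
Lemma esum_lt_nat (R : realType) (m : nat) (c : R) : (0 <= c)%R ->
  \esum_(n in [set: nat]) (if (n < m)%N then c%:E else 0) = (m%:R * c)%:E.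
Proof.
move=> c0; rewrite -nneseries_esumT; last by move=> n; case: ifP.
rewrite (@nneseries_split _ _ 0 m) => [|n _]; last by case: ifP.
rewrite add0n eseries_cond (eq_eseriesr (g := fun=> 0)); last first.
  by move=> n /=; rewrite ltnNge => ->.
rewrite eseries0// adde0 big_mkord (eq_bigr (fun=> c%:E)) => [|i _].
  by rewrite sumEFin sumr_const card_ord mulr_natl.
by rewrite ltn_ord.
Qed.

(** * Double zeta values as finite unordered sums *)

(** Rules out the default value 0 that [fine] in [zeta2] gives to an infinite sum. *)
Lemma zeta2_esum_lty (R : realType) (a b : R) : (1 < a)%R -> (2 < a + b)%R ->
  \esum_(x in [set x : nat * nat | (x.2 < x.1)%N])
    (riemannR a x.1 * riemannR b x.2)%:E < +oo.
Proof.
move=> a1 ab2.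
(* As k < j, part of the exponent a > 1 can be moved from j to k, leaving both
   exponents above 1: j^-a k^-b <= j^-(1 + e) k^-(a + b - 1 - e). *)
pose e : R := (Num.min (a - 1) (a + b - 2) / 2)%R.
have e0 : (0 < e)%R by rewrite divr_gt0// lt_min; apply/andP; split; lra.
(* This keeps the moved exponent a - 1 - e nonnegative; the next bound makes a + b - 1 - e exceed
   1. *)
have ea : (e <= a - 1)%R.
  by rewrite ler_pdivrMr// ge_min; apply/orP; left; lra.
have eab : (e < a + b - 2)%R.
  by rewrite ltr_pdivrMr// gt_min; apply/orP; right; lra.
have s1 : (1 < 1 + e)%R by lra.
have t1 : (1 < a + b - 1 - e)%R by lra.
pose F (x : nat * nat) :=
  (riemannR (1 + e) x.1 * riemannR (a + b - 1 - e) x.2)%:E.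
apply: (@le_lt_trans _ _ (\esum_(x in [set: nat] `*` [set: nat]) F x)).
  rewrite [leRHS](esumID [set x | (x.2 < x.1)%N]); last first.
    by move=> x _; rewrite lee_fin mulr_ge0// riemannR_ge0.
  rewrite -[leLHS]adde0 leeD//; last first.
    by apply: esum_ge0 => x _; rewrite lee_fin mulr_ge0// riemannR_ge0.
  rewrite setXTT setTI; apply: le_esum => -[j k] /= kj; rewrite lee_fin.
  have -> : (riemannR a j = riemannR (1 + e) j * riemannR (a - 1 - e) j)%R.
    by rewrite -riemannRD; congr riemannR; lra.
  have -> : (riemannR (a + b - 1 - e) k =
             riemannR (a - 1 - e) k * riemannR b k)%R.
    by rewrite -riemannRD; congr riemannR; lra.
  rewrite mulrA -!mulrA ler_wpM2l ?riemannR_ge0//.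
  by rewrite ler_wpM2r ?riemannR_ge0// ler_riemannR ?subr_ge0// ltnW.
by rewrite -(esumM _ _ _ _ _ _ _ (riemannR_ge0 R _) (riemannR_ge0 R _)
  (zeta_esum _ _ s1) (zeta_esum _ _ t1)) ltry.
Qed.

Lemma zeta2_esum (R : realType) (a b : R) : (1 < a)%R -> (2 < a + b)%R ->
  (zeta2 a b)%:E = \esum_(x in [set x : nat * nat | (x.2 < x.1)%N])
    (riemannR a x.1 * riemannR b x.2)%:E.
Proof.
move=> a1 ab2; rewrite -[RHS]fineK; last first.
  rewrite ge0_fin_numE ?zeta2_esum_lty// esum_ge0// => x _.
  by rewrite lee_fin mulr_ge0// riemannR_ge0.
(* Shifting both indices by 1 maps the pairs k < j onto the pairs counted from 1. *)
rewrite /zeta2 (reindex_esum [set x : nat * nat | (x.2 < x.1)%N] _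
    (fun x => (x.1.+1, x.2.+1))); last first.
  split=> [[j k]|[i j] [k l] _ _ [-> ->]|[[|j] [|k]]]//= kj.
  by exists (j, k).
by congr (fine _)%:E; apply: eq_esum => x _; rewrite !powRN.
Qed.

Lemma zeta2_swap_esum (R : realType) (a b : R) : (1 < a)%R -> (2 < a + b)%R ->
  (zeta2 a b)%:E = \esum_(x in [set x : nat * nat | (x.1 < x.2)%N])
    (riemannR b x.1 * riemannR a x.2)%:E.
Proof.
move=> a1 ab2; rewrite zeta2_esum//.
rewrite (reindex_esum [set x : nat * nat | (x.1 < x.2)%N] _
    (fun x => (x.2, x.1))); last first.
  split=> [[j k]|[i j] [k l] _ _ [-> ->]|[j k]]//= kj.
  by exists (k, j).
by apply: eq_esum => x _; rewrite mulrC.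
Qed.

(** * Summation of the products of tails *)

(** The condition n <= j, k is moved into the terms, so that the index set no longer depends on n
    and the sums can be exchanged. *)
Lemma zeta_tailM_esum (R : realType) (p q : R) n : (1 < p)%R -> (1 < q)%R ->
  ((zeta p - \sum_(1 <= j < n.+1) (j%:R `^ p)^-1) *
   (zeta q - \sum_(1 <= k < n.+1) (k%:R `^ q)^-1))%:E =
  \esum_(x in [set: nat * nat]) (if (n < (minn x.1 x.2).+1)%N
    then (riemannR p x.1 * riemannR q x.2)%:E else 0).
Proof.
move=> p1 q1.
rewrite (esumM _ _ _ _ _ _ _ (riemannR_ge0 R p) (riemannR_ge0 R q)
  (zeta_tail _ _ n p1) (zeta_tail _ _ n q1)) esum_mkcond.
apply: eq_esum => -[j k] _ /=; rewrite ltnS leq_min.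
by congr (if _ then _ else _); apply/idP/idP; rewrite inE/= => /andP.
Qed.

Lemma nneseries_zeta_tailM (R : realType) (p q : R) : (1 < p)%R -> (1 < q)%R ->
  \sum_(n <oo) ((zeta p - \sum_(1 <= j < n.+1) (j%:R `^ p)^-1) *
    (zeta q - \sum_(1 <= k < n.+1) (k%:R `^ q)^-1))%:E =
  \esum_(x in [set: nat * nat])
    ((minn x.1 x.2).+1%:R * (riemannR p x.1 * riemannR q x.2))%:E.
Proof.
move=> p1 q1.
have F0 (x : nat * nat) : (0 <= riemannR p x.1 * riemannR q x.2)%R.
  by rewrite mulr_ge0// riemannR_ge0.
under eq_eseriesr do rewrite zeta_tailM_esum//.
rewrite nneseries_esumT => [|n]; last first.
  by apply: esum_ge0 => x _; case: ifP; rewrite // lee_fin.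
rewrite exchange_esum => [|n x]; last by case: ifP; rewrite // lee_fin.
by apply: eq_esum => x _; rewrite esum_lt_nat.
Qed.

Lemma esum_minnS_riemannR (R : realType) (p q : R) :
  (1 < p)%R -> (1 < q)%R -> (3 < p + q)%R ->
  \esum_(x in [set: nat * nat])
    ((minn x.1 x.2).+1%:R * (riemannR p x.1 * riemannR q x.2))%:E =
  (zeta2 p (q - 1) + zeta2 q (p - 1) + zeta (p + q - 1))%:E.
Proof.
move=> p1 q1 pq3.
have F0 (x : nat * nat) :
    0 <= ((minn x.1 x.2).+1%:R * (riemannR p x.1 * riemannR q x.2))%:E.
  by rewrite lee_fin !mulr_ge0// riemannR_ge0.
(* After two splittings only the diagonal remains. In each part the factor [(minn j k).+1] lowers an
   exponent by 1, off the diagonal that of the smaller index. *)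
rewrite (esumID [set x | (x.2 < x.1)%N])// setTI setTI.
rewrite [X in _ + X](esumID [set x | (x.1 < x.2)%N])// addeA !EFinD.
congr (_ + _ + _).
- rewrite zeta2_esum//; last by lra.
  apply: eq_esum => -[j k] /= kj.
  by rewrite riemannRB1 (minn_idPr (ltnW kj)) mulrCA.
- rewrite zeta2_swap_esum//; last by lra.
  rewrite (_ : _ `&` _ = [set x : nat * nat | (x.1 < x.2)%N]); last first.
    by apply/seteqP; split=> -[j k] /=; [case|move=> jk; split=> //; lia].
  apply: eq_esum => -[j k] /= jk.
  by rewrite riemannRB1 (minn_idPl (ltnW jk)) mulrA.
- rewrite zeta_esum; last by lra.
  rewrite (reindex_esum [set: nat] _ (fun n => (n, n))); last first.
    split=> [n _|m n _ _ []//|[j k] /=]; first by rewrite /= ltnn.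
    by move=> [jk kj]; exists j => //; congr pair; lia.
  apply: eq_esum => n _ /=.
  by rewrite minnn riemannRB1 riemannRD.
Qed.

Close Scope ereal_scope.

Theorem theorem1 (R : realType) (p q : R)
  (hp : 1 < p) (hq : 1 < q) (hpq : 3 < p + q) :
  \sum_(1 <= n < N.+1)
     (zeta p - \sum_(1 <= j < n.+1) (j%:R `^ p)^-1) *
     (zeta q - \sum_(1 <= k < n.+1) (k%:R `^ q)^-1) @[N --> \oo] -->
  zeta2 p (q - 1) + zeta2 q (p - 1) + zeta (p + q - 1) - zeta p * zeta q.
Proof.
pose G n : R := (zeta p - \sum_(1 <= j < n.+1) (j%:R `^ p)^-1) *
  (zeta q - \sum_(1 <= k < n.+1) (k%:R `^ q)^-1).
have G0 n : (0 <= (G n)%:E)%E.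
  rewrite zeta_tailM_esum// esum_ge0// => x _; case: ifP => // _.
  by rewrite lee_fin mulr_ge0// riemannR_ge0.
have G00 : G 0 = zeta p * zeta q by rewrite /G !big_geq// !subr0.
have Gcvg : \sum_(0 <= n < N) G n @[N --> \oo] -->
    zeta2 p (q - 1) + zeta2 q (p - 1) + zeta (p + q - 1).
  (* The limit exists in the extended reals by nonnegativity; its value being real, [fine_cvg]
     brings the convergence back to [R]. *)
  have : cvgn (fun N => \sum_(0 <= n < N) (G n)%:E)%E by exact: is_cvg_nneseries.
  rewrite /= nneseries_zeta_tailM// esum_minnS_riemannR// => /fine_cvg.
  by under eq_fun do rewrite /= sumEFin.
have -> : (fun N => \sum_(1 <= n < N.+1) G n) =
    (fun N => \sum_(0 <= n < N.+1) G n - zeta p * zeta q).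
  by apply/funext => N; rewrite [in RHS]big_ltn// G00 addrAC subrr add0r.
apply: cvgB; last exact: cvg_cst.
by rewrite -cvg_shiftS in Gcvg.
Qed.
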